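(* Let $P$ be a finite poset and $Q$ a subposet of $P$. Then $P\searrow^{wd}Q$ if and only if $\Delta_{\mathscr P}(P)\searrow\!\!\searrow\Delta_{\mathscr P}(Q)$.
   Context: Posets are finite; a subposet carries the induced order. $P_{>p}=\{y\in P: y>p\}$ and $P_{<p}=\{y\in P:y<p\}$. A poset is a double cone with apex $a$ if $a$ is an element of it comparable with all its elements. An element $p\in P$ is weakly dismantlable if $P_{>p}\cup P_{<p}$ is a double cone with some apex $a$ (in particular $a\in P_{>p}\cup P_{<p}$). $P\searrow^{wd}Q$ means that one can go from $P$ to the subposet $Q$ by successively deleting (finitely many, possibly zero) elements, each weakly dismantlable in the poset from which it is deleted. $\Delta_{\mathscr P}(P)$ is the order complex of $P$: the simplicial complex whose simplices are the nonempty chains of $P$. A finite simplicial complex $K$ is a simplicial cone $aL$ if there are a (possibly empty) subcomplex $L$ and a vertex $a$ not in $L$ such that the simplices of $K$ are exactly $\{a\}$, the $\sigma\in L$ and the $\{a\}\cup\sigma$ with $\sigma\in L$. For a vertex $x$ of $K$, $\mathrm{lk}_K(x)=\{\sigma\in K: x\notin\sigma,\ \{x\}\cup\sigma\in K\}$ and $K-x=\{\sigma\in K: x\notin\sigma\}$. The vertex $x$ is dismantlable in $K$ if $\mathrm{lk}_K(x)$ is a simplicial cone; the deletion $K\searrow\!\!\searrow K-x$ of such a vertex is an elementary strong collapse, and $K\searrow\!\!\searrow L$ means that $L$ is obtained from $K$ by a finite (possibly empty) succession of elementary strong collapses. *)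

(* Defs.v *)
From HB Require Import structures.
From mathcomp Require Import all_boot all_order.

Set Implicit Arguments.
Unset Strict Implicit.
Unset Printing Implicit Defensive.

Import Order.TTheory.

(* Subposets of a finite poset T are sets A : {set T} with the order of T. *)
Section Posets.
Context {d : Order.disp_t} {T : finPOrderType d}.
Implicit Types (A B : {set T}) (p a : T).

Definition above A p : {set T} := [set y in A | (p < y)%O].
Definition below A p : {set T} := [set y in A | (y < p)%O].

Definition double_cone_apex A a : bool :=
  (a \in A) && [forall y in A, (a >=< y)%O].

Definition double_cone A : bool := [exists a, double_cone_apex A a].

Definition weakly_dismantlable A p : bool :=
  (p \in A) && double_cone (above A p :|: below A p).

Definition wd_step : rel {set T} := fun A B =>
  [exists p, weakly_dismantlable A p && (B == A :\ p)].

Definition wd_reduces : rel {set T} := connect wd_step.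

Definition chain (s : {set T}) : bool :=
  [forall x in s, forall y in s, (x >=< y)%O].

Definition order_complex A : {set {set T}} :=
  [set s : {set T} | [&& s != set0, s \subset A & chain s]].

End Posets.

(* A finite simplicial complex is its set of (nonempty) simplices inside a
   finite type V; its vertices are the x with [set x] \in K, so elements of V
   need not be vertices, and the empty complex is set0. *)
Section Complexes.
Context {V : finType}.
Implicit Types (K L : {set {set V}}) (a x : V).

Definition is_complex K : bool :=
  (set0 \notin K) &&
  [forall s in K, forall t : {set V}, (t != set0) && (t \subset s) ==> (t \in K)].

Definition vertex K x : bool := [set x] \in K.

Definition cone a L : {set {set V}} :=
  [set a] |: (L :|: [set a |: s | s : {set V} in L]).

Definition simplicial_cone K : bool :=
  [exists a, exists L, [&& is_complex L, ~~ vertex L a & K == cone a L]].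

Definition link K x : {set {set V}} :=
  [set s in K | (x \notin s) && (x |: s \in K)].

Definition deletion K x : {set {set V}} := [set s in K | x \notin s].

Definition dismantlable K x : bool := vertex K x && simplicial_cone (link K x).

Definition elementary_strong_collapse : rel {set {set V}} := fun K L =>
  [exists x, dismantlable K x && (L == deletion K x)].

Definition strong_collapses : rel {set {set V}} :=
  connect elementary_strong_collapse.

End Complexes.

Lemma is_complexP (V : finType) (K : {set {set V}}) :
  reflect (set0 \notin K /\ forall s t : {set V},
             s \in K -> t != set0 -> t \subset s -> t \in K)
          (is_complex K).
Proof.
apply: (iffP andP) => -[K0 Kd]; split=> //.
  move=> s t sK t0 ts; move/forall_inP/(_ s sK)/forallP/(_ t): Kd.
  by rewrite t0 ts.
apply/forall_inP=> s sK; apply/forallP=> t; apply/implyP=> /andP[t0 ts].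
exact: Kd sK t0 ts.
Qed.

Lemma order_complex_is_complex (d : Order.disp_t) (T : finPOrderType d)
  (A : {set T}) : is_complex (order_complex A).
Proof.
apply/is_complexP; split=> [|s t]; rewrite !inE ?eqxx //.
case/and3P=> _ sA /forall_inP sC t0 ts; rewrite t0 (subset_trans ts sA) /=.
apply/forall_inP=> x xt; apply/forall_inP=> y yt.
by move/forall_inP: (sC x (subsetP ts x xt)); apply; apply: (subsetP ts).
Qed.

Lemma link_is_complex (V : finType) (K : {set {set V}}) (x : V) :
  is_complex K -> is_complex (link K x).
Proof.
move=> /is_complexP[K0 Kd]; apply/is_complexP; split=> [|s t].
  by rewrite inE (negPf K0).
rewrite !inE => /and3P[sK xs xsK] t0 ts; rewrite (Kd s t) //=.
rewrite (contra (subsetP ts x) xs) (Kd _ _ xsK) ?setUS //.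
by apply/set0Pn; exists x; rewrite setU11.
Qed.

Lemma deletion_is_complex (V : finType) (K : {set {set V}}) (x : V) :
  is_complex K -> is_complex (deletion K x).
Proof.
move=> /is_complexP[K0 Kd]; apply/is_complexP; split=> [|s t].
  by rewrite inE (negPf K0).
rewrite !inE => /andP[sK xs] t0 ts; rewrite (Kd s t) //=.
exact: contra (subsetP ts x) xs.
Qed.

(* Main.v *)
Require Import Defs.
From mathcomp Require Import all_boot all_order.

(** The order complex translates the two notions of deletion into one another,
    one element at a time.  For [p] in [A], the simplices of the link of [p]
    are the chains of elements comparable with [p] and distinct from it, so the
    link is the order complex of [above A p :|: below A p]
    ([link_order_complex]).  An order complex is a simplicial cone exactly when
    the poset is a double cone ([simplicial_cone_order_complex]): as the order
    complex is a flag complex, being a cone with apex [a] only says that [a] is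
    joined by an edge to every other vertex, i.e. comparable with it.  Hence
    the dismantlable vertices are the weakly dismantlable elements.

    Deleting a vertex from an order complex leaves the order complex of the
    subposet without that element, so a sequence of elementary strong
    collapses from an order complex stays among order complexes.  As a poset is the set
    of vertices of its order complex, every such sequence comes from a unique
    sequence of subposets, which gives both directions at once. *)

Set Implicit Arguments.
Unset Strict Implicit.
Unset Printing Implicit Defensive.

Import Order.TTheory.

Section OrderComplex.
Context {d : Order.disp_t} {T : finPOrderType d}.
Implicit Types (A B s : {set T}) (L : {set {set T}}) (a p x y : T).

Lemma chainP s : reflect {in s &, forall x y, (x >=< y)%O} (chain s).
Proof.
apply: (iffP forall_inP) => [sC x y xs ys | sC x xs].
  exact: (forall_inP (sC x xs)).
by apply/forall_inP=> y ys; apply: sC.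
Qed.

Lemma chainU1 a s :
  chain (a |: s) = chain s && [forall y in s, (a >=< y)%O].
Proof.
apply/chainP/andP=> [asC | [/chainP sC /forall_inP aC] x y].
  split; first by apply/chainP=> x y xs ys; apply: asC; rewrite setU1r.
  by apply/forall_inP=> y ys; apply: asC; rewrite ?setU11 ?setU1r.
case/setU1P=> [->|xs] /setU1P[->|ys]; first exact: comparablexx.
- exact: aC.
- by rewrite comparable_sym aC.
- exact: sC.
Qed.

Lemma chain1 x : chain [set x].
Proof. by apply/chainP=> y z /set1P-> /set1P->; apply: comparablexx. Qed.

Lemma setU1_neq0 a s : a |: s != set0.
Proof. by apply/set0Pn; exists a; rewrite setU11. Qed.

Lemma vertex_order_complex A x : vertex (order_complex A) x = (x \in A).
Proof. by rewrite /vertex inE chain1 sub1set andbT -{1}(setU0 [set x]) setU1_neq0. Qed.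

Lemma order_complex_inj : injective (@order_complex d T).
Proof.
by move=> A B eqAB; apply/setP=> x; rewrite -!vertex_order_complex eqAB.
Qed.

Lemma deletion_order_complex A p :
  deletion (order_complex A) p = order_complex (A :\ p).
Proof.
by apply/setP=> s; rewrite !inE subsetD1; case: (p \in s); rewrite ?andbF ?andbT.
Qed.

Lemma in_above_below A p y :
  (y \in above A p :|: below A p) = [&& y \in A, y != p & (p >=< y)%O].
Proof.
rewrite !inE -andb_orr !lt_neqAle (eq_sym p) -andb_orr.
by rewrite /Order.comparable.
Qed.

Lemma link_order_complex A p :
  p \in A -> link (order_complex A) p = order_complex (above A p :|: below A p).
Proof.
move=> pA; apply/setP=> s; rewrite !inE setU1_neq0 chainU1 subUset sub1set pA /=.
have -> : (s \subset above A p :|: below A p) =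
    [&& s \subset A, p \notin s & [forall y in s, (p >=< y)%O]].
  apply/subsetP/and3P=> [sub | [/subsetP sA ps /forall_inP pC] y ys].
    have cmp y ys := etrans (esym (in_above_below A p y)) (sub y ys).
    split; first by apply/subsetP=> y /cmp/and3P[].
      by apply/negP=> /cmp; rewrite eqxx andbF.
    by apply/forall_inP=> y /cmp/and3P[].
  by rewrite in_above_below sA ?pC // (memPn ps) //.
by case: (s != set0) (s \subset A) (p \notin s) (chain s) => [] [] [] [];
  rewrite ?andbF ?andbT.
Qed.

Lemma order_complex_cone A a :
  double_cone_apex A a -> order_complex A = cone a (order_complex (A :\ a)).
Proof.
case/andP=> aA /forall_inP aC; rewrite -deletion_order_complex.
apply/setP=> s; apply/idP/idP=> [sK | ].
  have [as_ | aNs] := boolP (a \in s); last first.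
    by rewrite in_setU1 in_setU [s \in deletion _ _]in_set sK aNs orbT.
  have [s0 | sD0] := eqVneq (s :\ a) set0.
    by rewrite -(setD1K as_) s0 setU0 !inE eqxx.
  have /is_complexP[_ down] := order_complex_is_complex A.
  rewrite in_setU1 in_setU -{3}(setD1K as_) imset_f ?orbT //.
  by rewrite in_set setD11 (down s) ?subD1set.
rewrite !inE => /or3P[/eqP-> | /andP[] // | /imsetP[t]].
  by have := vertex_order_complex A a; rewrite aA /vertex inE => ->.
rewrite !inE => /andP[/and3P[_ tA tC] _] ->.
rewrite setU1_neq0 subUset sub1set aA tA chainU1 tC /=.
by apply/forall_inP=> y yt; apply/aC/(subsetP tA).
Qed.

(** From a cone on the order complex, comparability with the apex [a] is read
    off the edges [[set a; y]], which a cone contains for each of its vertices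
    [y] other than [a].  Conversely, adding to a chain an element comparable
    with everything gives a chain, so the base of the cone can be the order
    complex of [A :\ a]. *)
Lemma simplicial_cone_order_complex A :
  simplicial_cone (order_complex A) = double_cone A.
Proof.
apply/existsP/existsP=> -[a]; last first.
  move=> aA; exists a; apply/existsP; exists (order_complex (A :\ a)).
  rewrite order_complex_is_complex vertex_order_complex setD11.
  by rewrite (order_complex_cone aA) eqxx.
case/existsP=> L /and3P[_ _ /eqP KE]; exists a; apply/andP; split.
  by rewrite -vertex_order_complex KE /vertex !inE eqxx.
apply/forall_inP=> y; rewrite -vertex_order_complex /vertex KE !inE.
case/or3P=> [/eqP/set1_inj-> | yL | /imsetP[s _ /setP/(_ a)]].
- exact: comparablexx.
- have : a |: [set y] \in order_complex A.
    by rewrite KE in_setU1 in_setU (imset_f (setU [set a]) yL) !orbT.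
  rewrite inE => /and3P[_ _ /chainP]; apply; first exact: setU11.
  by rewrite setU1r ?set11.
- by rewrite setU11 => /set1P->; apply: comparablexx.
Qed.

Lemma dismantlable_order_complex A p :
  dismantlable (order_complex A) p = weakly_dismantlable A p.
Proof.
rewrite /dismantlable /weakly_dismantlable vertex_order_complex.
have [pA /= | //] := boolP (p \in A).
by rewrite link_order_complex // simplicial_cone_order_complex.
Qed.

Lemma elementary_strong_collapse_order_complex A B :
  elementary_strong_collapse (order_complex A) (order_complex B) = wd_step A B.
Proof.
apply: eq_existsb => p; rewrite dismantlable_order_complex.
by rewrite deletion_order_complex (inj_eq order_complex_inj).
Qed.

Lemma elementary_strong_collapse_from_order_complex A L :
  elementary_strong_collapse (order_complex A) L ->
  exists B, L = order_complex B.
Proof.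
by case/existsP=> p /andP[_ /eqP->]; exists (A :\ p); rewrite deletion_order_complex.
Qed.

Lemma strong_collapses_order_complex A B :
  strong_collapses (order_complex A) (order_complex B) = wd_reduces A B.
Proof.
apply/connectP/connectP=> -[q].
  elim: q A => [|L q IHq] A /=; first by move=> _ /order_complex_inj->; exists [::].
  case/andP=> step; case: (elementary_strong_collapse_from_order_complex step).
  move=> C LE; rewrite {}LE elementary_strong_collapse_order_complex in step *.
  by move=> Cq /(IHq C Cq)[r Cr ->]; exists (C :: r); rewrite //= step.
move=> Aq ->; exists (map (@order_complex d T) q); last by rewrite last_map.
rewrite path_map; apply: sub_path Aq => C D.
by rewrite /= elementary_strong_collapse_order_complex.
Qed.

End OrderComplex.

Theorem theorem5p1 (d : Order.disp_t) (P : finPOrderType d) (Q : {set P}) :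
  wd_reduces [set: P] Q <->
  strong_collapses (order_complex [set: P]) (order_complex Q).
Proof. by rewrite strong_collapses_order_complex. Qed.
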